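(* Let $S=S_1\sqcup S_2$ with $|S_1|=2$, $|S_2|=3$, let $(S,E)$ be the complete bipartite graph on $S$ with parts $S_1,S_2$, and let $\mathcal{N}=V\oplus W$ be the $2$-step nilpotent real Lie algebra associated with $(S,E)$. Let $\mathfrak{n}=V\oplus V\oplus W$ be the $16$-dimensional real Lie algebra with bracket $$[(x_1,x_2,w),(y_1,y_2,w')]=(0,0,[x_1,y_1]+[x_2,y_2]),\qquad x_i,y_i\in V,\ w,w'\in W,$$ where $[x_i,y_i]\in W$ is the bracket in $\mathcal{N}$. Then $\mathfrak{n}$ is an Anosov Lie algebra.
   Context: The $2$-step nilpotent Lie algebra associated with a finite simple graph $(S,E)$ is $\mathcal{N}=V\oplus W$, where $V$ is the real vector space with basis $S$ and $W$ is the subspace of $\wedge^2 V$ spanned by $\{\alpha\wedge\beta : \alpha,\beta\in S,\ \alpha\beta\in E\}$; the bracket is determined by $[\alpha,\beta]=\alpha\wedge\beta$ if $\alpha\beta\in E$, $[\alpha,\beta]=0$ if $\alpha,\beta \in S$ are not adjacent, and $[\mathcal{N},W]=0$. A real Lie algebra of dimension $n$ is called Anosov if it admits a Lie algebra automorphism $\tau$ that is hyperbolic (none of its complex eigenvalues has modulus $1$) and such that the matrix of $\tau$ lies in $\mathrm{GL}_n(\mathbb{Z})$ with respect to some $\mathbb{Z}$-basis, i.e. a basis with integer structure constants. *)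

(* Defs.v *)
From HB Require Import structures.
From mathcomp Require Import all_boot all_order all_algebra.
From mathcomp Require Import complex.
From mathcomp Require Import reals.
From mathcomp Require Import ring.

Set Implicit Arguments.
Unset Strict Implicit.
Unset Printing Implicit Defensive.

Import Order.TTheory GRing.Theory Num.Theory.
Local Open Scope ring_scope.

Record lieAlgebra (R : realType) := LieAlgebra {
  lie_car :> vectType R;
  lie_br : lie_car -> lie_car -> lie_car;
  lie_brDl : forall (a : R) x y z,
    lie_br (a *: x + y) z = a *: lie_br x z + lie_br y z;
  lie_brDr : forall (a : R) x y z,
    lie_br z (a *: x + y) = a *: lie_br z x + lie_br z y;
  lie_brxx : forall x, lie_br x x = 0;
  lie_jacobi : forall x y z,
    lie_br x (lie_br y z) + lie_br y (lie_br z x) + lie_br z (lie_br x y) = 0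
}.
Arguments lie_br {R l} x y.

Section Anosov.
Variables (R : realType) (L : lieAlgebra R).

Definition lie_automorphism (tau : 'End(L)) : Prop :=
  bijective tau /\ (forall x y, tau (lie_br x y) = lie_br (tau x) (tau y)).

(* The choice of basis is irrelevant, see complex_eigenvalue_basis below. *)
Definition complex_eigenvalue (tau : 'End(L)) (z : R[i]) : bool :=
  eigenvalue (map_mx (real_complex R)
    (passmx.mxof (vbasis {:L}) (vbasis {:L}) tau)) z.

Definition hyperbolic (tau : 'End(L)) : Prop :=
  forall z : R[i], complex_eigenvalue tau z -> `|z| != 1.

Definition Z_basis (X : (\dim {:L}).-tuple L) : Prop :=
  basis_of {:L} X /\
  forall i j k : 'I_(\dim {:L}),
    coord X k (lie_br (tnth X i) (tnth X j)) \is a Num.int.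

(* [unitmx] over [int] is GL_n(Z).  [passmx.mxof] acts on row vectors, i.e. it
   is the transpose of the usual matrix of tau, which is immaterial here. *)
Definition integral_unimodular (X : (\dim {:L}).-tuple L) (tau : 'End(L)) :=
  exists2 A : 'M[int]_(\dim {:L}), A \in unitmx &
    passmx.mxof X X tau = map_mx intr A.

Definition Anosov : Prop :=
  exists tau : 'End(L), [/\ lie_automorphism tau, hyperbolic tau &
    exists2 X : (\dim {:L}).-tuple L, Z_basis X & integral_unimodular X tau].

End Anosov.

Lemma complex_eigenvalue_basis (R : realType) (L : lieAlgebra R)
    (X : (\dim {:L}).-tuple L) (tau : 'End(L)) (z : R[i]) :
  basis_of {:L} X ->
  complex_eigenvalue tau z =
  eigenvalue (map_mx (real_complex R) (passmx.mxof X X tau)) z.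
Proof.
move=> bX; rewrite /complex_eigenvalue.
have bY := vbasisP {:L}; move: (vbasis _) bY => Y bY.
suff sub (X1 X2 : (\dim {:L}).-tuple L) :
    basis_of {:L} X1 -> basis_of {:L} X2 ->
    eigenvalue (map_mx (real_complex R) (passmx.mxof X1 X1 tau)) z ->
    eigenvalue (map_mx (real_complex R) (passmx.mxof X2 X2 tau)) z.
  by apply/idP/idP; apply: sub.
move=> b1 b2 /eigenvalueP [v vP v0].
pose P := passmx.mxof X1 X2 \1%VF; pose Q := passmx.mxof X2 X1 \1%VF.
have PQ : P *m Q = 1%:M.
  apply/row_matrixP => i; rewrite !rowE mulmxA !passmx.mul_mxof mulmx1 !lfunE /=.
  by rewrite passmx.rVofK // passmx.vecofK.
have com : P *m passmx.mxof X2 X2 tau = passmx.mxof X1 X1 tau *m P.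
  apply/row_matrixP => i; rewrite !rowE !mulmxA !passmx.mul_mxof !lfunE /=.
  by rewrite !passmx.rVofK.
apply/eigenvalueP; exists (v *m map_mx (real_complex R) P).
  by rewrite -mulmxA -map_mxM com map_mxM mulmxA vP -scalemxAl.
apply: contra_neq v0 => vP0.
by rewrite -[v]mulmx1 -(map_mx1 (real_complex R)) -PQ map_mxM mulmxA vP0 mul0mx.
Qed.

Record simpleGraph (S : finType) := SimpleGraph {
  adj :> rel S;
  adj_sym : symmetric adj;
  adj_irr : irreflexive adj
}.

Definition complete_bipartite (S : finType) (G : simpleGraph S)
    (S1 S2 : {set S}) : Prop :=
  forall x y, G x y = (x \in S1) && (y \in S2) || (x \in S2) && (y \in S1).

Section GraphLieAlgebra.
Variables (R : realType) (S : finType) (G : simpleGraph S).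

Definition graphV : vectType R := {ffun S -> R^o}.

Definition vtx (a : S) : graphV := [ffun s => (s == a)%:R].

(* The exterior square of V is realized as the space of alternating tensors in
   V (x) V = R^(S * S), with u /\ v = u (x) v - v (x) u. *)
Definition graphT : vectType R := {ffun S * S -> R^o}.

Definition wedge (u v : graphV) : graphT :=
  [ffun p : S * S => u p.1 * v p.2 - u p.2 * v p.1].

Definition graphWspace : {vspace graphT} :=
  <<[seq wedge (vtx p.1) (vtx p.2) | p <- enum [pred p : S * S | G p.1 p.2]]>>%VS.

Definition graphW : vectType R := subvs_of graphWspace.

Lemma wedge_vtx_mem a b : G a b -> wedge (vtx a) (vtx b) \in graphWspace.
Proof.
move=> Gab; apply: memv_span; apply/mapP.
by exists (a, b) => //; rewrite mem_enum.
Qed.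

(* [vsproj] is the identity on graphWspace, so this is the element a /\ b of W
   if ab is an edge. *)
Definition br_vtx (a b : S) : graphW :=
  if G a b then vsproj graphWspace (wedge (vtx a) (vtx b)) else 0.

Definition brV (u v : graphV) : graphW :=
  \sum_a \sum_b (u a * v b) *: br_vtx a b.

Lemma br_vtxN a b : br_vtx a b = - br_vtx b a.
Proof.
rewrite /br_vtx adj_sym; case: ifP => _; last by rewrite oppr0.
rewrite -linearN; congr vsproj; apply/ffunP => p; rewrite !ffunE /=; ring.
Qed.

Lemma brVDl (a : R) x y z : brV (a *: x + y) z = a *: brV x z + brV y z.
Proof.
rewrite /brV scaler_sumr -big_split; apply: eq_bigr => i _ /=.
rewrite scaler_sumr -big_split; apply: eq_bigr => j _ /=.
by rewrite !ffunE scalerA -scalerDl mulrDl mulrA.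
Qed.

Lemma brVN x y : brV x y = - brV y x.
Proof.
rewrite /brV exchange_big -sumrN; apply: eq_bigr => i _ /=.
rewrite -sumrN; apply: eq_bigr => j _ /=.
by rewrite br_vtxN scalerN mulrC.
Qed.

Lemma brVDr (a : R) x y z : brV z (a *: x + y) = a *: brV z x + brV z y.
Proof. by rewrite brVN brVDl opprD -scalerN -!(brVN z). Qed.

Lemma brVxx x : brV x x = 0.
Proof.
have /eqP := brVN x x; rewrite -addr_eq0 -mulr2n -scaler_nat scaler_eq0.
by rewrite pnatr_eq0 => /eqP.
Qed.

Lemma brV0 x : brV x 0 = 0.
Proof.
rewrite /brV big1 // => i _; rewrite big1 // => j _.
by rewrite ffunE mulr0 scale0r.
Qed.

Lemma brV_vtx a b : brV (vtx a) (vtx b) = br_vtx a b.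
Proof.
rewrite /brV (bigD1 a) //= [X in _ + X]big1 ?addr0 => [|i /negPf ia]; last first.
  by rewrite big1 // => j _; rewrite !ffunE ia mul0r scale0r.
rewrite (bigD1 b) //= [X in _ + X]big1 ?addr0 => [|j /negPf jb].
  by rewrite !ffunE !eqxx mulr1 scale1r.
by rewrite !ffunE jb mulr0 scale0r.
Qed.

Lemma brV_edge a b :
  G a b -> vsval (brV (vtx a) (vtx b)) = wedge (vtx a) (vtx b).
Proof. by move=> Gab; rewrite brV_vtx /br_vtx Gab vsprojK ?wedge_vtx_mem. Qed.

Lemma brV_nonedge a b : ~~ G a b -> brV (vtx a) (vtx b) = 0.
Proof. by move=> /negPf Gab; rewrite brV_vtx /br_vtx Gab. Qed.

Definition br_graph (x y : graphV * graphW) : graphV * graphW :=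
  (0, brV x.1 y.1).

Lemma br_graphDl (a : R) x y z :
  br_graph (a *: x + y) z = a *: br_graph x z + br_graph y z.
Proof. by apply: injective_projections; rewrite /= ?scaler0 ?addr0 ?brVDl. Qed.

Lemma br_graphDr (a : R) x y z :
  br_graph z (a *: x + y) = a *: br_graph z x + br_graph z y.
Proof. by apply: injective_projections; rewrite /= ?scaler0 ?addr0 ?brVDr. Qed.

Lemma br_graphxx x : br_graph x x = 0.
Proof. by rewrite /br_graph brVxx. Qed.

Lemma br_graph_jacobi x y z :
  br_graph x (br_graph y z) + br_graph y (br_graph z x) +
  br_graph z (br_graph x y) = 0.
Proof.
by apply: injective_projections; rewrite /= ?brV0 !addr0.
Qed.

Definition graph_lie : lieAlgebra R :=
  @LieAlgebra R (graphV * graphW)%type br_graph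
    br_graphDl br_graphDr br_graphxx br_graph_jacobi.

(* For u, v in V, (lie_br (inV u) (inV v)).2 is the bracket of graph_lie, whose
   V-component is 0, seen as an element of W. *)
Definition inV (u : graphV) : graph_lie := (u, 0 : graphW).

Definition br_double (x y : graphV * graphV * graphW) :
    graphV * graphV * graphW :=
  (0, 0, (lie_br (inV x.1.1) (inV y.1.1)).2 +
         (lie_br (inV x.1.2) (inV y.1.2)).2).

Lemma br_doubleDl (a : R) x y z :
  br_double (a *: x + y) z = a *: br_double x z + br_double y z.
Proof.
apply: injective_projections; first apply: injective_projections;
  rewrite /= ?scaler0 ?addr0 //.
by rewrite !brVDl scalerDr addrACA.
Qed.

Lemma br_doubleDr (a : R) x y z :
  br_double z (a *: x + y) = a *: br_double z x + br_double z y.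
Proof.
apply: injective_projections; first apply: injective_projections;
  rewrite /= ?scaler0 ?addr0 //.
by rewrite !brVDr scalerDr addrACA.
Qed.

Lemma br_doublexx x : br_double x x = 0.
Proof. by rewrite /br_double /= !brVxx addr0. Qed.

Lemma br_double_jacobi x y z :
  br_double x (br_double y z) + br_double y (br_double z x) +
  br_double z (br_double x y) = 0.
Proof.
by rewrite /br_double /= !brV0; apply: injective_projections;
  first apply: injective_projections; rewrite /= ?addr0.
Qed.

Definition double_lie : lieAlgebra R :=
  @LieAlgebra R (graphV * graphV * graphW)%type br_double
    br_doubleDl br_doubleDr br_doublexx br_double_jacobi.

End GraphLieAlgebra.

Lemma dim_double_lie (R : realType) (S : finType) (G : simpleGraph S)
    (S1 S2 : {set S}) :
  S1 :|: S2 = [set: S] -> [disjoint S1 & S2] -> #|S1| = 2%N -> #|S2| = 3%N ->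
  complete_bipartite G S1 S2 ->
  \dim {:double_lie R G} = 16%N.
Proof.
move=> S12 dis c1 c2 cb.
have cS : #|S| = 5%N.
  by rewrite -cardsT -S12 cardsU (disjoint_setI0 dis) cards0 c1 c2.
have dW : \dim (graphWspace R G) = 6%N.
  pose s := enum (setX S1 S2).
  pose b := [seq wedge (vtx R p.1) (vtx R p.2) | p <- s].
  have n21 a : a \in S2 -> (a \in S1) = false.
    by move=> a2; apply: (disjointFl dis).
  have sb : size (in_tuple b) = 6%N by rewrite size_map -cardE cardsX c1 c2.
  have fb : free (in_tuple b).
    apply/freeP => k k0 i.
    have sE : size b = size s by rewrite size_map.
    have ls (j : 'I_(size b)) : (j < size s)%N by rewrite -sE.
    have [p0 _] : exists p0 : S * S, true.
      by have := ls i; case: (s) => [//|p0 ? _]; exists p0.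
    have /= := congr1 (fun f : graphT R S => f (nth p0 s i)) k0.
    rewrite sum_ffunE ffunE (bigD1 i) //= big1 ?addr0.
      rewrite (nth_map p0) // !ffunE !eqxx.
      have : nth p0 s i \in s by rewrite mem_nth.
      rewrite mem_enum inE => /andP [i1 i2].
      have /negPf -> : (nth p0 s i).1 != (nth p0 s i).2.
        by apply: contraTneq i1 => ->; rewrite n21.
      by rewrite mulr0 subr0 mulr1 [_ *: _]mulr1.
    move=> j ji; rewrite (nth_map p0) // !ffunE.
    have := mem_nth p0 (ls i); have := mem_nth p0 (ls j).
    rewrite !mem_enum !inE => /andP [j1 j2] /andP [i1 i2].
    have -> : ((nth p0 s i).1 == (nth p0 s j).2) = false.
      by apply/negbTE; apply: contraTneq i1 => ->; rewrite n21.
    rewrite mulr0 subr0 -natrM mulnb -[_ && _]/(_ == _ :> S * S).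
    rewrite nth_uniq ?enum_uniq // -val_eqE /= in ji *.
    by rewrite eq_sym (negPf ji) scaler0.
  rewrite -[RHS]sb -(eqP fb); congr (\dim _); apply/eqP; rewrite eqEsubv.
  apply/andP; split; apply/span_subvP => v /mapP [[x y]].
    rewrite mem_enum inE /= cb => /orP [] /andP [xS yS] ->.
      by apply: memv_span; apply/mapP; exists (x, y); rewrite // mem_enum inE xS.
    suff -> : wedge (vtx R x) (vtx R y) = - wedge (vtx R y) (vtx R x).
      rewrite memvN; apply: memv_span; apply/mapP; exists (y, x) => //.
      by rewrite mem_enum inE xS yS.
    by apply/ffunP => p; rewrite !ffunE /= opprB mulrC [X in _ - X]mulrC.
  rewrite mem_enum inE => /andP [xS yS] -> /=.
  by apply: wedge_vtx_mem; rewrite cb xS yS.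
rewrite dimvf; change ((#|S| * 1 + #|S| * 1 + \dim (graphWspace R G))%N = 16%N).
by rewrite cS dW.
Qed.

(* Main.v *)
Require Import Defs.
From HB Require Import structures.
From mathcomp Require Import all_boot all_order all_algebra.
From mathcomp Require Import complex reals ring lra.

(** Identify the two copies of R^S1 with 2 x 2 matrices X, the two copies of
    R^S2 with 2 x 3 matrices Y, and W with 2 x 3 matrices; the bracket becomes
    X Y' - X' Y.  For invertible integer P, Q, T the map
    (X, Y, W) |-> (P X Q^-1, Q Y T, P W T) is an automorphism preserving the
    integral points.  Take P with eigenvalues the roots of x^2 = x + 1,
    Q = P^2, and T the inverse of a matrix whose eigenvalues are the roots of
    x^3 = x + 1.  An eigenvalue z of modulus 1 gives an intertwining relation
    M U = z U N with U <> 0, hence an eigenvalue d of N such that z d is an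
    eigenvalue of M; thus N and M have eigenvalues of the same modulus.  The
    moduli are powers phi^(+-1), phi^(+-2) of the golden ratio for P and Q,
    whereas a root of x^3 = x + 1 of modulus r has 1 - r <= r^3 <= r + 1. *)

Set Implicit Arguments.
Unset Strict Implicit.
Unset Printing Implicit Defensive.

Import Order.TTheory GRing.Theory Num.Theory.
Local Open Scope ring_scope.
Local Notation normc := ComplexField.Normc.normc.

(** * Intertwined matrices and common eigenvalues *)

Lemma mulmx_horner_mx (F : comNzRingType) m n (A : 'M[F]_m.+1) (B : 'M[F]_n.+1)
    (U : 'M[F]_(m.+1, n.+1)) (p : {poly F}) :
  A *m U = U *m B -> horner_mx A p *m U = U *m horner_mx B p.
Proof.
move=> AU; elim/poly_ind: p => [|p c IH]; first by rewrite !rmorph0 mul0mx mulmx0.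
rewrite !rmorphD !rmorphM /= !horner_mx_X !horner_mx_C mulmxDl mulmxDr.
by rewrite -mulmxA AU mulmxA IH -mulmxA mul_scalar_mx mul_mx_scalar.
Qed.

(** If the characteristic polynomials were coprime, a Bezout relation evaluated at [B] would give
    [u(B) chi_A(B) = 1]. Moving [(u chi_A)(A) = 0] across [U] would then yield [U = 0]. So they have
    a common root. *)
Lemma intertwining_eigenvalue (F : closedFieldType) m n (A : 'M[F]_m.+1)
    (B : 'M[F]_n.+1) (U : 'M[F]_(m.+1, n.+1)) :
  A *m U = U *m B -> U != 0 -> exists2 a, eigenvalue A a & eigenvalue B a.
Proof.
move=> AU U0.
have : ~~ coprimep (char_poly A) (char_poly B).
  apply: contraNN U0 => /Bezout_eq1_coprimepP [[u v] /= uv].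
  have := congr1 (horner_mx B) uv; rewrite rmorphD !rmorphM rmorph1 /=.
  rewrite Cayley_Hamilton mulr0 addr0 => uA.
  have := mulmx_horner_mx (u * char_poly A) AU.
  rewrite !rmorphM /= uA Cayley_Hamilton mulr0 mul0mx => /esym.
  by rewrite mulmx1 => ->.
rewrite coprimep_def => /closed_rootP [a]; rewrite root_gcd => /andP [ra rb].
by exists a; rewrite eigenvalue_root_char.
Qed.

Lemma eigenvalue_horner_mx (F : fieldType) n (A : 'M[F]_n.+1) (p : {poly F}) a :
  horner_mx A p = 0 -> eigenvalue A a -> root p a.
Proof. by move=> /mxminpoly_min /root_dvdp + ra; apply; rewrite -eigenvalue_root_min. Qed.


(** * Moduli of the roots of x^2 = x + 1, x^2 = 3x - 1 and x^3 = x + 1 *)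

Section Moduli.
Variable R : realType.
Implicit Types e d : R[i].

Lemma normc_ge0 e : 0 <= normc e.
Proof. by case: e => a b; apply: sqrtr_ge0. Qed.

Lemma normc_complexr (a : R) : normc (a +i* 0)%C = `|a|.
Proof. by rewrite /= expr0n addr0 sqrtr_sqr. Qed.

Lemma complex_eq_components (a b a' b' : R) :
  (a +i* b = a' +i* b')%C -> a = a' /\ b = b'.
Proof. by case. Qed.

Lemma modulus_root_golden e : e ^+ 2 = e + 1 ->
  normc e ^+ 2 = normc e + 1 \/ normc e ^+ 2 = 1 - normc e.
Proof.
case: e => a b; rewrite expr2 => /complex_eq_components [ha hb].
(* A nonzero [b] would force a = 1/2 from 2ab = b, and then b^2 = a^2 - a - 1 < 0. *)
have b0 : b = 0 by nra.
move: ha; rewrite b0 normc_complexr => ha.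
by case: (lerP 0 a) => a0; [left; rewrite ger0_norm|right; rewrite ltr0_norm]; nra.
Qed.

Lemma modulus_root_golden_square e : e ^+ 2 = e *+ 3 - 1 ->
  normc e ^+ 2 = 3 * normc e - 1.
Proof.
case: e => a b; rewrite expr2 => /complex_eq_components [ha hb].
(* A nonzero [b] would force a = 3/2 and b^2 = -5/4. Once [b] is 0, 3a = a^2 + 1 makes [a]
   positive. *)
have b0 : b = 0 by nra.
by move: ha; rewrite b0 normc_complexr => ha; rewrite ger0_norm; nra.
Qed.

(** Since |d|^3 = |d + 1|, both bounds are triangle inequalities, the second one for 1 = (d + 1) -
    d. *)
Lemma modulus_root_plastic d : d ^+ 3 = d + 1 ->
  normc d ^+ 3 <= normc d + 1 /\ 1 - normc d <= normc d ^+ 3.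
Proof.
move=> hd.
have -> : normc d ^+ 3 = normc (d + 1).
  by rewrite -hd !exprS expr0 !mulr1 !ComplexField.Normc.normcM.
have n1 := ComplexField.Normc.normc1 R.
split; first by rewrite -n1; apply: le_normcD.
have := le_normcD (d + 1) (- d).
by rewrite normcN addrC addKr n1 lerBlDr.
Qed.

End Moduli.

(** * Integer matrices and their annihilating polynomials *)

(* [[0,1],[1,1]], the companion matrix of x^2 - x - 1. *)
Definition goldenmx : 'M[int]_2 := \matrix_(i, j) (0 < i + j)%:R.

(* [[0,1,0],[0,0,1],[1,1,0]], the companion matrix of x^3 - x - 1. *)
Definition plasticmx : 'M[int]_3 :=
  \matrix_(i, j) (if val i == 2 then j != 2 :> nat else j == i.+1 :> nat)%:R.

Lemma goldenmx_sqr : goldenmx *m goldenmx = goldenmx + 1%:M.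
Proof.
apply/matrixP => -[[|[|//]] i] -[[|[|//]] j];
  by rewrite !mxE !big_ord_recl big_ord0 !mxE.
Qed.

(** The roots of x^2 - 3x + 1 are the squares of the roots of x^2 - x - 1, so this polynomial
    annihilates the square of [goldenmx]. *)
Lemma goldenmx_pow4 : goldenmx *m goldenmx *m (goldenmx *m goldenmx) + 1%:M =
  (goldenmx *m goldenmx) *+ 3.
Proof.
apply/matrixP => -[[|[|//]] i] -[[|[|//]] j];
  by rewrite !(mulmxnE, mxE, big_ord_recl, big_ord0).
Qed.

Lemma plasticmx_cube : plasticmx *m plasticmx *m plasticmx = plasticmx + 1%:M.
Proof.
apply/matrixP => -[[|[|[|//]]] i] -[[|[|[|//]]] j];
  by rewrite !(mxE, big_ord_recl, big_ord0).
Qed.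

(** * No eigenvalue of modulus 1 on any of the three blocks *)

Section Hyperbolicity.
Variable R : realType.
Local Notation A := (map_mx intr goldenmx : 'M[R[i]]_2).
Local Notation D := (map_mx intr plasticmx : 'M[R[i]]_3).

(** [U] intertwines [M] with z N, and an eigenvalue a of z N is z times the eigenvalue a / z of
    [N]. *)
Lemma intertwining_scaled_eigenvalue (F : closedFieldType) m n (M : 'M[F]_m.+1)
    (N : 'M[F]_n.+1) (U : 'M[F]_(m.+1, n.+1)) z :
  z != 0 -> M *m U = z *: (U *m N) -> U != 0 ->
  exists2 a, eigenvalue N a & eigenvalue M (z * a).
Proof.
move=> z0; rewrite scalemxAr => MU /(intertwining_eigenvalue MU) [a aM].
case/eigenvalueP => v vN v0; exists (a / z); last by rewrite mulrC divfK.
apply/eigenvalueP; exists v => //; apply: (scalerI z0).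
by rewrite scalemxAr vN scalerA mulrC divfK.
Qed.

Lemma goldenmx_eigenvalue (e : R[i]) : eigenvalue A e -> e ^+ 2 = e + 1.
Proof.
have hA : horner_mx A ('X^2 - 'X - 1) = 0.
  rewrite !rmorphB rmorph1 rmorphXn /= horner_mx_X expr2 -[A * A]map_mxM.
  by rewrite goldenmx_sqr map_mxD map_mx1 addrAC addrK subrr.
move=> /(eigenvalue_horner_mx hA); rewrite /root !hornerE subr_eq0 subr_eq.
by rewrite addrC => /eqP.
Qed.

Lemma goldenmx_sqr_eigenvalue (e : R[i]) :
  eigenvalue (A *m A) e -> e ^+ 2 = e *+ 3 - 1.
Proof.
have hA : horner_mx (A *m A) ('X^2 - 'X *+ 3 + 1) = 0.
  rewrite addrAC rmorphB rmorphD rmorph1 rmorphMn rmorphXn /= horner_mx_X expr2.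
  have := congr1 (map_mx (intr : int -> R[i])) goldenmx_pow4.
  rewrite raddfMn /= map_mxD !map_mxM map_mx1 => AE.
  by rewrite -[A *m A * _ + 1]/(_ *m _ + 1%:M) AE subrr.
move=> /(eigenvalue_horner_mx hA) /rootP; rewrite !hornerE => he.
by apply/eqP; rewrite -subr_eq0 -he /=; apply/eqP; ring.
Qed.

Lemma plasticmx_eigenvalue (d : R[i]) : eigenvalue D d -> d ^+ 3 = d + 1.
Proof.
have hD : horner_mx D ('X^3 - 'X - 1) = 0.
  rewrite !rmorphB rmorph1 rmorphXn /= horner_mx_X !exprSr expr0 mul1r.
  rewrite -[_ * _ * _]/(_ *m _ *m _) -!map_mxM.
  by rewrite plasticmx_cube map_mxD map_mx1 addrAC addrK subrr.
move=> /(eigenvalue_horner_mx hD); rewrite /root !hornerE subr_eq0 subr_eq.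
by rewrite addrC => /eqP.
Qed.

Variable z : R[i].
Hypothesis z1 : normc z = 1.

Lemma unit_modulus_neq0 : z != 0.
Proof.
by apply: contra_eq_neq z1 => ->; rewrite ComplexField.Normc.normc0 eq_sym oner_eq0.
Qed.

Lemma golden_golden_hyperbolic (X : 'M_2) : A *m X = z *: (X *m (A *m A)) -> X = 0.
Proof.
move=> AX; have [//|X0] := eqVneq X 0; exfalso.
have [d hd he] := intertwining_scaled_eigenvalue unit_modulus_neq0 AX X0.
have := modulus_root_golden (goldenmx_eigenvalue he).
have := modulus_root_golden_square (goldenmx_sqr_eigenvalue hd).
(* For the common modulus r, r^2 = 3r - 1 together with r^2 = r + 1 gives r = 1, and together with
   r^2 = 1 - r gives r = 1/2; neither value satisfies the equations. *)
by rewrite ComplexField.Normc.normcM z1 mul1r; nra.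
Qed.

Lemma golden_square_plastic_hyperbolic (Y : 'M_(2, 3)) :
  A *m A *m Y = z *: (Y *m D) -> Y = 0.
Proof.
move=> AY; have [//|Y0] := eqVneq Y 0; exfalso.
have [d hd he] := intertwining_scaled_eigenvalue unit_modulus_neq0 AY Y0.
have [] := modulus_root_plastic (plasticmx_eigenvalue hd).
have := modulus_root_golden_square (goldenmx_sqr_eigenvalue he).
rewrite ComplexField.Normc.normcM z1 mul1r.
move: (normc d : R) => r r2.
have -> : r ^+ 3 = 8 * r - 3 by rewrite exprS r2; nra.
(* The bounds 1 - r <= 8r - 3 <= r + 1 confine r to [4/9, 4/7], where r^2 - 3r + 1 is negative. *)
by nra.
Qed.

Lemma golden_plastic_hyperbolic (W : 'M_(2, 3)) : A *m W = z *: (W *m D) -> W = 0.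
Proof.
move=> AW; have [//|W0] := eqVneq W 0; exfalso.
have [d hd he] := intertwining_scaled_eigenvalue unit_modulus_neq0 AW W0.
have [] := modulus_root_plastic (plasticmx_eigenvalue hd).
have := modulus_root_golden (goldenmx_eigenvalue he).
rewrite ComplexField.Normc.normcM z1 mul1r.
have := normc_ge0 d; move: (normc d : R) => r r0.
case=> r2; rewrite [r ^+ 3]exprS r2 => h1 h2; last first.
  (* Case r^2 = 1 - r: here r^3 = 2r - 1, so 1 - r <= r^3 gives r >= 2/3, whereas r(3r - 2) = 3 - 5r
     >= 0 gives r <= 3/5. *)
  have r23 : 2 <= 3 * r by nra.
  have : 0 <= r * (3 * r - 2) by rewrite mulr_ge0 ?subr_ge0.
  by nra.
(* Case r^2 = r + 1: here r^3 = 2r + 1 <= r + 1, hence r <= 0. *)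
have r00 : r = 0 by nra.
by move: r2; rewrite r00 expr0n add0r => /eqP; rewrite eq_sym oner_eq0.
Qed.

End Hyperbolicity.

(** * A criterion for being Anosov in integral coordinates *)

Lemma mxOver_int_map (R : realType) m n (A : 'M[R]_(m, n)) :
  A \is a mxOver Num.int -> exists B : 'M[int]_(m, n), A = map_mx intr B.
Proof.
move=> /mxOverP intA; exists (map_mx Num.floor A).
by apply/matrixP => i j; rewrite !mxE; apply/esym/eqP; rewrite -intrEfloor.
Qed.

(* In the last hypothesis x and y are the real and imaginary parts of an
   eigenvector for c + is. *)
Lemma Anosov_coordinates (R : realType) (L : lieAlgebra R) (n : nat)
    (kappa : 'Hom(L, 'rV[R]_n)) (tau tau' : 'End(L)) :
  \dim {:L} = n -> injective kappa ->
  (forall x y, kappa x \is a mxOver Num.int -> kappa y \is a mxOver Num.int ->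
     kappa (lie_br x y) \is a mxOver Num.int) ->
  cancel tau tau' -> cancel tau' tau ->
  (forall x y, tau (lie_br x y) = lie_br (tau x) (tau y)) ->
  (forall x, kappa x \is a mxOver Num.int -> kappa (tau x) \is a mxOver Num.int) ->
  (forall x, kappa x \is a mxOver Num.int -> kappa (tau' x) \is a mxOver Num.int) ->
  (forall (c s : R) (x y : L), normc (c +i* s)%C = 1 ->
     tau x = c *: x - s *: y -> tau y = s *: x + c *: y -> x = 0 /\ y = 0) ->
  Anosov L.
Proof.
move=> dimL; case: n / dimL kappa => kappa kinj brint tauK tauK' tbr tint tint' hyp.
have ker0 : lker kappa == 0%VS by apply/lker0P.
have img : limg kappa = fullv.
  apply/eqP; rewrite eqEdim subvf limg_dim_eq ?(eqP ker0) ?capv0 //.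
  by rewrite [\dim {:'rV_ _}]dimvf /= /dim /= mul1n.
have kK v : kappa (kappa^-1%VF v) = v by rewrite limg_lfunVK // img memvf.
(* The preimage of the standard basis is the candidate Z-basis; the coordinates of a vector in it
   are the entries of its image under [kappa]. *)
pose X := [tuple kappa^-1%VF 'e_i | i < \dim {:L}].
have kX (i : 'I_(\dim {:L})) : kappa X`_i = 'e_i.
  by rewrite -[X`_i]tnth_nth tnth_mktuple kK.
have kvec v : kappa (passmx.vecof X v) = v.
  rewrite linear_sum [RHS]row_sum_delta; apply: eq_bigr => i _.
  by rewrite linearZ; congr (_ *: _); exact: kX.
have bX : basis_of {:L} X.
  rewrite basisEfree subvf size_tuple leqnn !andbT; apply/freeP => k k0 i.
  have /(congr1 kappa) : passmx.vecof X (\row_i k i) = 0.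
    by rewrite -[RHS]k0; apply: eq_bigr => j _; rewrite mxE.
  by rewrite kvec linear0 => /rowP /(_ i); rewrite !mxE.
have rVE v : passmx.rVof X v = kappa v.
  have {1}<- : passmx.vecof X (kappa v) = v by apply: kinj; rewrite kvec.
  by rewrite (passmx.vecofK bX).
have kXint (i : 'I_(\dim {:L})) : kappa X`_i \is a mxOver Num.int.
  by rewrite kX; apply/mxOverP => k l; rewrite mxE rpred_nat.
have mxint (f : 'End(L)) : (forall x, kappa x \is a mxOver Num.int ->
    kappa (f x) \is a mxOver Num.int) ->
    passmx.mxof X X f \is a mxOver Num.int.
  move=> fint; apply/mxOverP => i j.
  have -> : passmx.mxof X X f i j = kappa (f X`_i) 0 j.
    by rewrite -rVE (passmx.rVof_app X bX) (passmx.rVofE bX) -rowE [RHS]mxE.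
  exact: (mxOverP (fint _ (kXint i))) 0 j.
exists tau; split.
- by split; first exists tau'.
- move=> [c s]; rewrite (complex_eigenvalue_basis tau _ bX).
  case/eigenvalueP => v vM v0; apply: contra_neqN v0 => /eqP cs1.
  pose Mx := passmx.mxof X X tau.
  pose x := passmx.vecof X (map_mx (@complex.Re R) v).
  pose y := passmx.vecof X (map_mx (@complex.Im R) v).
  (* As [Mx] is real, the real and imaginary parts of this identity are the two equations required
     of [x] and [y]. *)
  have vj j : \sum_i (v 0 i * (Mx i j)%:C)%C = ((c +i* s) * v 0 j)%C.
    have /rowP /(_ j) := vM; rewrite !mxE => <-.
    by apply: eq_bigr => i _; rewrite [in RHS]mxE.
  have [] : x = 0 /\ y = 0.
    apply: (hyp c s).
    - by move: cs1; rewrite normc_def => /complexI.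
    - apply: kinj; rewrite linearB !linearZ /= !kvec.
      rewrite (passmx.hom_vecof X bX) kvec; apply/rowP => j; rewrite [LHS]mxE.
      transitivity (complex.Re ((c +i* s) * v 0 j)%C).
        rewrite -vj raddf_sum; apply: eq_bigr => i _; rewrite mxE.
        by case: (v 0 i) => a b /=; rewrite mulr0 subr0.
      by rewrite !mxE; case: (v 0 j) => a b /=; rewrite mulrN.
    - apply: kinj; rewrite linearD !linearZ /= !kvec.
      rewrite (passmx.hom_vecof X bX) kvec; apply/rowP => j; rewrite [LHS]mxE.
      transitivity (complex.Im ((c +i* s) * v 0 j)%C).
        rewrite -vj raddf_sum; apply: eq_bigr => i _; rewrite mxE.
        by case: (v 0 i) => a b /=; rewrite mulr0 add0r.
      by rewrite !mxE; case: (v 0 j) => a b /=; rewrite addrC.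
  move=> /(congr1 kappa) + /(congr1 kappa).
  rewrite !kvec !linear0 => /rowP re0 /rowP im0; apply/rowP => j.
  by have := re0 j; have := im0 j; rewrite !mxE; case: (v 0 j) => a b /= -> ->.
- exists X; first split => // i j k.
    rewrite passmx.coord_rVof rVE.
    have := brint _ _ (kXint i) (kXint j) => /mxOverP /(_ 0 k).
    by rewrite -!tnth_nth.
  have [A AE] := mxOver_int_map (mxint _ tint).
  have [B BE] := mxOver_int_map (mxint _ tint').
  (* The matrix [B] of [tau'] is an integral inverse of [A]; since integer matrices embed into real
     ones, this can be checked over [R]. *)
  exists A => //; suff AB : A *m B = 1%:M by case/mulmx1_unit: AB.
  have : injective (map_mx (intr : int -> R) : 'M_(\dim {:L}) -> _).
    move=> M N /matrixP MN; apply/matrixP => i j.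
    by have := MN i j; rewrite !mxE => /intr_inj.
  apply; rewrite map_mxM -AE -BE map_mx1 -(passmx.mxof_comp X X bX).
  rewrite -(passmx.mxof1 (basis_free bX)); congr passmx.mxof.
  by apply/lfunP => x; rewrite !lfunE /= tauK.
Qed.

(** * Coordinates on W and the bracket of V *)

Section GraphW.
Variables (R : realType) (S : finType) (G : simpleGraph S).

Lemma graphWspace_ind (P : graphT R S -> Prop) :
  P 0 -> (forall (c : R) f g, P f -> P g -> P (c *: f + g)) ->
  (forall a b, G a b -> P (wedge (vtx R a) (vtx R b))) ->
  forall f, f \in graphWspace R G -> P f.
Proof.
move=> P0 PD Pw f; rewrite /graphWspace; set l := map _ _ => fl.
rewrite (coord_span (X := in_tuple l) fl).
elim/big_ind: _ => // [g h Pg Ph|i _]; first by rewrite -[g]scale1r; apply: PD.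
rewrite -[_ *: _]addr0; apply: PD => //.
have /mapP [[a b]] := mem_nth 0 (ltn_ord i).
by rewrite mem_enum /= => Gab ->; apply: Pw.
Qed.

Lemma graphW_antisym (w : graphW R G) s t : vsval w (s, t) = - vsval w (t, s).
Proof.
apply: (graphWspace_ind (P := fun f => f (s, t) = - f (t, s))) (subvsP w).
- by rewrite !ffunE oppr0.
- by move=> c f g fE gE; rewrite !ffunE fE gE scalerN opprD.
- by move=> a b _; rewrite !ffunE /= opprB mulrC [X in _ - X]mulrC.
Qed.

Lemma graphW_nonedge (w : graphW R G) s t : ~~ G s t -> vsval w (s, t) = 0.
Proof.
move=> Gst; apply: (graphWspace_ind (P := fun f => f (s, t) = 0)) (subvsP w).
- by rewrite ffunE.
- by move=> c f g fE gE; rewrite !ffunE fE gE scaler0 addr0.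
- move=> a b Gab; rewrite !ffunE /=.
  have [/eqP|] := boolP ((s == a) && (t == b)).
    by move/eqP=> /andP [/eqP sa /eqP tb]; rewrite sa tb Gab in Gst.
  rewrite -natrM mulnb => /negPf ->.
  have [|] := boolP ((t == a) && (s == b)).
    by move=> /andP [/eqP ta /eqP sb]; rewrite sb ta adj_sym Gab in Gst.
  by rewrite -natrM mulnb => /negPf ->; rewrite subrr.
Qed.

Lemma brV_edgeE (u v : graphV R S) s t : G s t ->
  vsval (brV G u v) (s, t) = u s * v t - u t * v s.
Proof.
move=> Gst; have br a b : vsval (br_vtx R G a b) (s, t) =
    wedge (vtx R a) (vtx R b) (s, t).
  rewrite /br_vtx; case: ifP => [Gab|Gab]; first by rewrite vsprojK ?wedge_vtx_mem.
  rewrite linear0 !ffunE /= -!natrM !mulnb.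
  have [/andP [/eqP sa /eqP tb]|_] := boolP ((s == a) && (t == b)).
    by rewrite -sa -tb Gst in Gab.
  have [/andP [/eqP ta /eqP sb]|_] := boolP ((t == a) && (s == b)).
    by rewrite -sb -ta adj_sym Gst in Gab.
  by rewrite subrr.
rewrite /brV linear_sum sum_ffunE.
under eq_bigr => a _.
  rewrite linear_sum sum_ffunE.
  under eq_bigr => b _.
    rewrite linearZ ffunE /= br !ffunE /= [_ *: _]mulrBr.
  over.
  rewrite sumrB.
over.
(* Only (a, b) = (s, t) contributes to the first sum, and only (a, b) = (t, s) to the second. *)
rewrite sumrB; congr (_ - _).
  rewrite (bigD1 s) //= [X in _ + X]big1 ?addr0 => [|i /negPf si]; last first.
    by apply: big1 => j _; rewrite eq_sym si mul0r mulr0.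
  rewrite (bigD1 t) //= [X in _ + X]big1 ?addr0 ?eqxx ?mulr1 // => j /negPf tj.
  by rewrite [t == j]eq_sym tj !mulr0.
rewrite (bigD1 t) //= [X in _ + X]big1 ?addr0 => [|i /negPf si]; last first.
  by apply: big1 => j _; rewrite eq_sym si mul0r mulr0.
rewrite (bigD1 s) //= [X in _ + X]big1 ?addr0 ?eqxx ?mulr1 // => j /negPf tj.
by rewrite [s == j]eq_sym tj !mulr0.
Qed.

End GraphW.

(** The two real equations say that Z = U + iV satisfies P Z Q' = (c + is) Z; multiplying by [Q] on
    the right gives the complex intertwining relation, which forces Z = 0. *)
Lemma intertwining_real_pair (R : realType) m n (P : 'M[int]_m) (Q Q' : 'M[int]_n)
    (c s : R) (U V : 'M[R]_(m, n)) :
  Q' *m Q = 1%:M ->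
  (forall Z : 'M[R[i]]_(m, n), map_mx intr P *m Z =
     (c +i* s)%C *: (Z *m map_mx intr Q) -> Z = 0) ->
  map_mx intr P *m U *m map_mx intr Q' = c *: U - s *: V ->
  map_mx intr P *m V *m map_mx intr Q' = s *: U + c *: V ->
  U = 0 /\ V = 0.
Proof.
move=> QQ inj hU hV.
have cancelQ (N N' : 'M[R]_(m, n)) :
    N *m map_mx intr Q' = N' -> N = N' *m map_mx intr Q.
  by move=> <-; rewrite -mulmxA -map_mxM QQ map_mx1 mulmx1.
have mapC k l (N : 'M[int]_(k, l)) :
    map_mx intr N = map_mx (real_complex R) (map_mx intr N) :> 'M[R[i]]_(k, l).
  by apply/matrixP => i j; rewrite !mxE rmorph_int.
have Z0 : map_mx (real_complex R) U + 'i%C *: map_mx (real_complex R) V = 0.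
  apply: inj; rewrite !mapC mulmxDr -scalemxAr mulmxDl -scalemxAl -!map_mxM.
  rewrite (cancelQ _ _ hU) (cancelQ _ _ hV) mulmxBl mulmxDl -!scalemxAl.
  apply/matrixP => i j; move: (U *m _) (V *m _) => N N'.
  by rewrite !mxE; simpc; congr (_ +i* _)%C; ring.
by split; apply/matrixP => i j; have /matrixP /(_ i j) := Z0;
  rewrite !mxE; simpc => -[].
Qed.

(** * The matrix model and its automorphisms *)

Section Model.
Variable R : realType.

Definition model : vectType R := ('M[R]_2 * 'M[R]_(2, 3) * 'M[R]_(2, 3))%type.

Definition model_br (x y : model) : model :=
  (0, 0, x.1.1 *m y.1.2 - y.1.1 *m x.1.2).

(** [Q'] stands for the inverse of [Q]; as a separate integer matrix it makes the integrality of the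
    map immediate. *)
Definition model_act (P Q Q' : 'M[int]_2) (T : 'M[int]_3) (x : model) : model :=
  (map_mx intr P *m x.1.1 *m map_mx intr Q',
   map_mx intr Q *m x.1.2 *m map_mx intr T,
   map_mx intr P *m x.2 *m map_mx intr T).

Lemma model_act_linear P Q Q' T : linear (model_act P Q Q' T).
Proof.
move=> c x y; rewrite /model_act /=.
by rewrite !(mulmxDl, mulmxDr, =^~ scalemxAl, =^~ scalemxAr).
Qed.

HB.instance Definition _ P Q Q' T := GRing.isLinear.Build R model model *:%R
  (model_act P Q Q' T) (@model_act_linear P Q Q' T).

(** The inner factors cancel: (P X Q')(Q Y T) = P (X Y) T. *)
Lemma model_act_br P Q Q' T x y : Q' *m Q = 1%:M ->
  model_act P Q Q' T (model_br x y) =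
  model_br (model_act P Q Q' T x) (model_act P Q Q' T y).
Proof.
move=> QQ; rewrite /model_act /model_br /= !mulmx0 !mul0mx.
have red (U : 'M[R]_2) (V : 'M[R]_(2, 3)) :
    map_mx intr P *m U *m map_mx intr Q' *m
      (map_mx intr Q *m V *m map_mx intr T) =
    map_mx intr P *m (U *m V) *m map_mx intr T.
  rewrite -!mulmxA; congr (_ *m (_ *m _)).
  by rewrite !mulmxA -map_mxM QQ map_mx1 mul1mx.
by rewrite !red mulmxBr mulmxBl.
Qed.

Lemma model_actK P Q Q' T P' T' : P' *m P = 1%:M -> Q' *m Q = 1%:M ->
  Q *m Q' = 1%:M -> T *m T' = 1%:M ->
  cancel (model_act P Q Q' T) (model_act P' Q' Q T').
Proof.
move=> PP QQ QQ' TT [[X Y] W]; rewrite /model_act /=.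
have red m n (A A' : 'M[int]_m) (B B' : 'M[int]_n) (U : 'M[R]_(m, n)) :
    A' *m A = 1%:M -> B *m B' = 1%:M ->
    map_mx intr A' *m (map_mx intr A *m U *m map_mx intr B) *m map_mx intr B' = U.
  move=> AA BB; rewrite -!mulmxA -map_mxM BB map_mx1 mulmx1 mulmxA -map_mxM AA.
  by rewrite map_mx1 mul1mx.
by rewrite !red.
Qed.

Definition model_row (x : model) : 'rV[R]_(2 * 2 + 2 * 3 + 2 * 3) :=
  row_mx (row_mx (mxvec x.1.1) (mxvec x.1.2)) (mxvec x.2).

Lemma model_row_linear : linear model_row.
Proof.
by move=> c x y; rewrite /model_row /= !linearP /= !scale_row_mx !add_row_mx.
Qed.

HB.instance Definition _ := GRing.isLinear.Build R model _ *:%R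
  model_row model_row_linear.

Lemma model_row_inj : injective model_row.
Proof.
move=> [[X Y] W] [[X' Y'] W'] /eq_row_mx [/eq_row_mx [hX hY] hW].
by congr (_, _, _); apply: (can_inj mxvecK).
Qed.

Lemma model_row_int (x : model) : (model_row x \is a mxOver Num.int) =
  [&& x.1.1 \is a mxOver Num.int, x.1.2 \is a mxOver Num.int
    & x.2 \is a mxOver Num.int].
Proof.
have vec m n (U : 'M[R]_(m, n)) :
    (mxvec U \is a mxOver Num.int) = (U \is a mxOver Num.int).
  apply/mxOverP/mxOverP => h i j; first by rewrite -mxvecE.
  by rewrite ord1; case/mxvec_indexP: j => k l; rewrite mxvecE.
have row m n (u : 'rV[R]_m) (v : 'rV_n) : (row_mx u v \is a mxOver Num.int) =
    (u \is a mxOver Num.int) && (v \is a mxOver Num.int).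
  apply/mxOverP/andP => [h|[/mxOverP hu /mxOverP hv] i j]; last first.
    by rewrite mxE; case: splitP => k _.
  by split; apply/mxOverP => i j; have := h i;
    [move=> /(_ (lshift _ j)); rewrite row_mxEl|
     move=> /(_ (rshift _ j)); rewrite row_mxEr].
by rewrite !row !vec andbA.
Qed.

Lemma mxOver_int_intr m n (A : 'M[int]_(m, n)) :
  (map_mx intr A : 'M[R]_(m, n)) \is a mxOver Num.int.
Proof. by apply/mxOverP => i j; rewrite mxE intr_int. Qed.

Lemma model_act_int P Q Q' T x : model_row x \is a mxOver Num.int ->
  model_row (model_act P Q Q' T x) \is a mxOver Num.int.
Proof.
rewrite !model_row_int /= => /and3P [hX hY hW].
by apply/and3P; split; rewrite !mxOverM ?mxOver_int_intr.
Qed.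

Lemma model_br_int x y : model_row x \is a mxOver Num.int ->
  model_row y \is a mxOver Num.int -> model_row (model_br x y) \is a mxOver Num.int.
Proof.
rewrite !model_row_int /= => /and3P [hX hY _] /and3P [hX' hY' _].
have int0 m n : (0 : 'M[R]_(m, n)) \is a mxOver Num.int by apply: mxOver0.
rewrite !int0 /=; apply/mxOverP => i j; rewrite !mxE.
by rewrite rpredB // rpred_sum // => k _; rewrite rpredM //; apply/mxOverP.
Qed.

End Model.

(** Write P for [goldenmx], D for [plasticmx] and z = c + is. On the complexified blocks the
    eigenvector equation becomes P X = z X P^2, P^2 Y = z Y D and P W = z W D, each of which has
    only the zero solution. *)
Lemma model_hyperbolic (R : realType) P' T (c s : R) (x y : model R) :
  let B := goldenmx *m goldenmx in
  P' *m goldenmx = 1%:M -> T *m plasticmx = 1%:M ->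
  normc (c +i* s)%C = 1 ->
  let f := model_act goldenmx B (P' *m P') T in
  f x = c *: x - s *: y -> f y = s *: x + c *: y -> x = 0 /\ y = 0.
Proof.
case: x y => [[X Y] W] [[X' Y'] W'] B PP TT cs1 f [hX hY hW] [hX' hY' hW'].
have BB : P' *m P' *m B = 1%:M.
  by rewrite /B mulmxA -[P' *m P' *m _]mulmxA PP mulmx1.
have [] := intertwining_real_pair BB _ hX hX'.
  by move=> Z; rewrite map_mxM; apply: golden_golden_hyperbolic.
have [] := intertwining_real_pair TT _ hY hY'.
  by move=> Z; rewrite map_mxM; apply: golden_square_plastic_hyperbolic.
have [] := intertwining_real_pair TT _ hW hW'.
  by move=> Z; apply: golden_plastic_hyperbolic.
by move=> -> -> -> -> -> ->.
Qed.

Lemma goldenmx_inv : exists A', A' *m goldenmx = 1%:M.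
Proof.
(* P^2 = P + 1 amounts to (P - 1) P = 1. *)
exists (goldenmx - 1%:M); rewrite mulmxBl goldenmx_sqr mul1mx addrC.
by rewrite addKr.
Qed.

Lemma plasticmx_inv : exists D', D' *m plasticmx = 1%:M.
Proof.
(* D^3 = D + 1 amounts to (D^2 - 1) D = 1. *)
exists (plasticmx *m plasticmx - 1%:M).
by rewrite mulmxBl plasticmx_cube mul1mx addrC addKr.
Qed.

(** * Identification of the Lie algebra with the matrix model *)

Section GraphModel.
Variables (R : realType) (S : finType) (G : simpleGraph S).
Variables (a : 'I_2 -> S) (b : 'I_3 -> S).
Hypothesis Gab : forall i k, G (a i) (b k).
Hypothesis Gaa : forall i j, ~~ G (a i) (a j).
Hypothesis Gbb : forall k l, ~~ G (b k) (b l).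
Hypothesis cover_ab : forall s, (exists i, s = a i) \/ (exists k, s = b k).

(** The two copies of V index the columns of X and the rows of Y, so that the product X Y' sums over
    the copies as the bracket does. *)
Definition graph_model (x : double_lie R G) : model R :=
  (\matrix_(i, j) (if j == ord0 then x.1.1 else x.1.2) (a i),
   \matrix_(j, k) (if j == ord0 then x.1.1 else x.1.2) (b k),
   \matrix_(i, k) vsval x.2 (a i, b k)).

Lemma graph_model_linear : linear graph_model.
Proof.
move=> c [[x1 x2] w] [[y1 y2] w']; apply: injective_projections;
  first apply: injective_projections; apply/matrixP => i j;
  rewrite !mxE /= ?linearP ?ffunE //=; by case: ifP; rewrite !ffunE.
Qed.

HB.instance Definition _ := GRing.isLinear.Build R (double_lie R G) (model R) *:%R
  graph_model graph_model_linear.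

(** An element of W is determined by its values at the pairs [(a i, b k)], being antisymmetric and
    zero at nonadjacent pairs. *)
Lemma graph_model_inj : injective graph_model.
Proof.
move=> x y xy; apply/eqP; rewrite -subr_eq0; apply/eqP.
have {xy} : graph_model (x - y) = 0 by rewrite linearB /= xy subrr.
case: (x - y) => [[u v] w] [/matrixP hX /matrixP hY /matrixP hW].
have u0 : u = 0.
  apply/ffunP => s; rewrite ffunE.
  by case: (cover_ab s) => [[i ->]|[k ->]];
    [have := hX i ord0|have := hY ord0 k]; rewrite !mxE.
have v0 : v = 0.
  apply/ffunP => s; rewrite ffunE.
  by case: (cover_ab s) => [[i ->]|[k ->]];
    [have := hX i ord_max|have := hY ord_max k]; rewrite !mxE.
have wab i k : vsval w (a i, b k) = 0 by have := hW i k; rewrite !mxE.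
have w0 : w = 0.
  apply: val_inj; apply/ffunP => -[s t]; rewrite [RHS]ffunE.
  case: (cover_ab s) (cover_ab t) => [[i ->]|[k ->]] [[j ->]|[l ->]].
  - exact: graphW_nonedge.
  - exact: wab.
  - by rewrite [LHS]graphW_antisym wab oppr0.
  - exact: graphW_nonedge.
by rewrite u0 v0 w0.
Qed.

Lemma graph_model_br x y :
  graph_model (lie_br x y) = model_br (graph_model x) (graph_model y).
Proof.
apply: injective_projections; first apply: injective_projections;
  apply/matrixP => i j; rewrite !mxE /=; try by case: ifP; rewrite ffunE.
rewrite ffunE !brV_edgeE // !big_ord_recl !big_ord0 !mxE /=; ring.
Qed.

Lemma Anosov_graph_model : \dim {:double_lie R G} = 16 -> Anosov (double_lie R G).
Proof.
move=> dimL; have [A' AA] := goldenmx_inv; have [D' DD] := plasticmx_inv.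
pose B := goldenmx *m goldenmx; pose B' := A' *m A'.
have AA' := mulmx1C AA; have DD' := mulmx1C DD.
have BB : B' *m B = 1%:M by rewrite /B mulmxA -[B' *m _]mulmxA AA mulmx1.
have BB' := mulmx1C BB.
pose phi : 'Hom(double_lie R G, model R) := linfun graph_model.
have phiE x : phi x = graph_model x by rewrite lfunE.
have phi_inj : injective phi by move=> x y; rewrite !phiE => /graph_model_inj.
have ker0 : lker phi == 0%VS by apply/lker0P.
have img : limg phi = fullv.
  apply/eqP; rewrite eqEdim subvf limg_dim_eq ?(eqP ker0) ?capv0 // dimL.
  by rewrite dimvf.
have phiK x : phi (phi^-1%VF x) = x by rewrite limg_lfunVK // img memvf.
(* The factor [T] is [D'], the inverse of [plasticmx]. Exchanging every matrix with its inverse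
   gives the inverse map [f']. *)
pose f := model_act (R := R) goldenmx B B' D'.
pose f' := model_act (R := R) A' B' B plasticmx.
pose tau := (phi^-1 \o linfun f \o phi)%VF.
pose tau' := (phi^-1 \o linfun f' \o phi)%VF.
have tauE x : graph_model (tau x) = f (graph_model x).
  by rewrite -!phiE 2!comp_lfunE phiK [linfun _ _]lfunE.
have tauE' x : graph_model (tau' x) = f' (graph_model x).
  by rewrite -!phiE 2!comp_lfunE phiK [linfun _ _]lfunE.
pose kappa := (linfun (@model_row R) \o phi)%VF.
have kappaE x : kappa x = model_row (graph_model x) by rewrite comp_lfunE phiE lfunE.
apply: (Anosov_coordinates (kappa := kappa) (tau := tau) (tau' := tau')) => //.
- by move=> x y; rewrite !kappaE => /model_row_inj /graph_model_inj.
- by move=> x y; rewrite !kappaE graph_model_br; apply: model_br_int.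
- by move=> x; apply: graph_model_inj; rewrite tauE' tauE; apply: model_actK.
- by move=> x; apply: graph_model_inj; rewrite tauE tauE'; apply: model_actK.
- move=> x y; apply: graph_model_inj.
  by rewrite tauE !graph_model_br !tauE; apply: model_act_br.
- by move=> x; rewrite !kappaE tauE; apply: model_act_int.
- by move=> x; rewrite !kappaE tauE'; apply: model_act_int.
move=> c s x y cs1 /(congr1 graph_model) hx /(congr1 graph_model) hy.
move: hx hy; rewrite !tauE linearB linearD !linearZ /= ?scalerN => hx hy.
have [x0 y0] := model_hyperbolic AA DD cs1 hx hy.
by split; apply: graph_model_inj; rewrite ?x0 ?y0 linear0.
Qed.

End GraphModel.

Local Close Scope ring_scope.

Theorem mainTheorem7 (R : realType) (S : finType) (G : simpleGraph S)
    (S1 S2 : {set S}) :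
  S1 :|: S2 = [set: S] -> [disjoint S1 & S2] -> #|S1| = 2 -> #|S2| = 3 ->
  complete_bipartite G S1 S2 ->
  Anosov (double_lie R G).
Proof.
move=> S12 dis c1 c2 cb.
pose a (i : 'I_2) := enum_val (cast_ord (esym c1) i).
pose b (k : 'I_3) := enum_val (cast_ord (esym c2) k).
have aS i : a i \in S1 by apply: enum_valP.
have bS k : b k \in S2 by apply: enum_valP.
have aN i : (a i \in S2) = false by apply: (disjointFr dis).
have bN k : (b k \in S1) = false by apply: (disjointFl dis).
apply: (@Anosov_graph_model _ _ _ a b).
- by move=> i k; rewrite cb aS bS.
- by move=> i j; rewrite cb !aN andbF.
- by move=> k l; rewrite cb !bN andbF.
- move=> s; have := in_setT s; rewrite -S12 inE => /orP [] sS; [left|right].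
    exists (cast_ord c1 (enum_rank_in sS s)).
    by rewrite /a cast_ordK enum_rankK_in.
  exists (cast_ord c2 (enum_rank_in sS s)).
  by rewrite /b cast_ordK enum_rankK_in.
- exact: dim_double_lie S12 dis c1 c2 cb.
Qed.
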